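(* Let $n$ be a positive even integer. For any $x\in\mathbb{R}^d$ the inequality $$\mathbb{P}(a_1X_1+\cdots+a_nX_n=x)\le \mathbb{P}(X_1-X_2+\cdots+X_{n-1}-X_n=0)$$ holds in each of the following two situations: (a) $X_1,\dots,X_n$ are independent identically distributed discrete real random variables and $a_1,\dots,a_n\in\mathbb{R}^d$ are any non-zero vectors; (b) $X_1,\dots,X_n$ are independent identically distributed discrete random vectors in $\mathbb{R}^d$ and $a_1,\dots,a_n\in\mathbb{R}$ are any non-zero real numbers.
   Context: A random variable or vector is discrete if it takes values in a countable set almost surely. On the right-hand side, $0$ denotes the zero of the space where the $X_i$ take values. *)

(* Defs.v *)
From HB Require Import structures.
From mathcomp Require Import all_boot all_order all_algebra.
From mathcomp Require Import all_classical all_reals all_analysis.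
Import numFieldNormedType.Exports.

Set Implicit Arguments.
Unset Strict Implicit.
Unset Printing Implicit Defensive.

Local Open Scope classical_set_scope.
Local Open Scope ring_scope.

(* 'rV[R]_d with its Borel sigma-algebra, the one generated by the open sets
   of the usual (norm) topology; its carrier is convertible to 'rV[R]_d, and
   values have to be cast to the latter to recover the vector space
   structure. *)
Definition borelRd (R : realType) (d : nat) : measurableType _ :=
  g_sigma_algebraType (@open 'rV[R]_d).

Section families_of_random_variables.
Context {dT dS : measure_display} {T : measurableType dT}
  {S : measurableType dS} {R : realType} (P : probability T R).

(* Only almost sure countability of the range is required, whereas the
   library's {dRV P >-> S} asks for a countable range. *)
Definition discrete_rv (X : {RV P >-> S}) : Prop :=
  exists2 C : set S, countable C & {ae P, forall w, C (X w)}.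

Definition mutually_independent (I : finType) (X : I -> {RV P >-> S}) : Prop :=
  forall (J : {set I}) (A : I -> set S),
    (forall i, i \in J -> measurable (A i)) ->
    P (\bigcap_(i in [set` J]) (X i @^-1` A i)) =
      (\prod_(i in J) P (X i @^-1` A i))%E.

(* [distribution P (X i)] is a total function on [set S], meaningful on
   measurable sets only; hence no plain equality of functions. *)
Definition identically_distributed (I : finType) (X : I -> {RV P >-> S}) :
    Prop :=
  forall (i j : I) (A : set S), measurable A ->
    distribution P (X i) A = distribution P (X j) A.

End families_of_random_variables.

(* Main.v *)
(* Let p be the common law restricted to a finite set, and, for maps
   u_1, ..., u_n with values in an abelian group, let m(u_1, ..., u_n) be the
   mass at 0 of the law of u_1(Y_1) + ... + u_n(Y_n) for independent Y_i of
   law p. For n even, AM-GM bounds twice the mass of u_1(Y_1) + ... + u_n(Y_n)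
   at any point by m(u, -u) + m(u', -u'), where u and u' are the two halves of
   the tuple. Hence, if a tuple with entries among the maps +-(a_i * _)
   maximizes m, so does (u, -u), whatever half u of it is chosen; repeating
   this reaches a maximizer in which a single a_i occurs. As a_i is non-zero,
   its mass is P(Y_1 - Y_2 + ... - Y_n = 0). The discrete case follows by
   exhausting the support of the law by finite sets. *)

Require Import Defs.
From HB Require Import structures.
From mathcomp Require Import all_boot all_order all_algebra finmap.
From mathcomp Require Import all_classical all_reals all_analysis.
From mathcomp Require Import measurable_realfun lra zify.
Import numFieldNormedType.Exports.

Set Implicit Arguments.
Unset Strict Implicit.
Unset Printing Implicit Defensive.

Import Order.TTheory GRing.Theory Num.Theory.

Local Open Scope classical_set_scope.
Local Open Scope ring_scope.

(** * Convolution sums over finitely many weighted values *)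

Section convolution_sum.
Context {R : realFieldType} {J : eqType} {K : Type} {G : zmodType}.
Variables (D : seq K) (p : K -> R) (U : J -> K -> G).
Implicit Types (s t : seq J) (F : G -> R).

(* [csum s F] is the expectation of F(\sum_(j in s) U_j(Y_j)) for independent
   Y_j with values in D and (not necessarily normalized) weights p. *)
Fixpoint csum s F : R :=
  if s is j :: s' then \sum_(y <- D) p y * csum s' (fun g => F (U j y + g))
  else F 0.

Lemma eq_csum s F F' : F =1 F' -> csum s F = csum s F'.
Proof.
elim: s F F' => [|j s IH] F F' eqF /=; first exact: eqF.
by apply: eq_bigr => y _; congr (_ * _); apply: IH => g; apply: eqF.
Qed.

Lemma csumZ s c F : csum s (fun g => c * F g) = c * csum s F.
Proof.
elim: s F => [//|j s IH] F /=; rewrite mulr_sumr.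
by apply: eq_bigr => y _; rewrite IH mulrCA.
Qed.

Lemma csum_sum (I : Type) (r : seq I) s (F : I -> G -> R) :
  csum s (fun g => \sum_(i <- r) F i g) = \sum_(i <- r) csum s (F i).
Proof.
elim: s F => [//|j s IH] F /=; rewrite exchange_big /=.
by apply: eq_bigr => y _; rewrite IH mulr_sumr.
Qed.

Lemma csum_cat s t F :
  csum (s ++ t) F = csum s (fun g => csum t (fun h => F (g + h))).
Proof.
elim: s F => [|j s IH] F /=; first by apply: eq_csum => h; rewrite add0r.
apply: eq_bigr => y _; rewrite IH; congr (_ * _).
by apply: eq_csum => g; apply: eq_csum => h; rewrite addrA.
Qed.

Lemma exchange_csum s t (F : G -> G -> R) :
  csum s (fun g => csum t (F g)) = csum t (fun h => csum s (F^~ h)).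
Proof.
elim: s F => [//|j s IH] F /=; rewrite csum_sum.
by apply: eq_bigr => y _; rewrite IH -csumZ.
Qed.

Lemma csum_catC s t F : csum (s ++ t) F = csum (t ++ s) F.
Proof.
rewrite !csum_cat exchange_csum.
by apply: eq_csum => g; apply: eq_csum => h; rewrite addrC.
Qed.

Lemma perm_csum s t F : perm_eq s t -> csum s F = csum t F.
Proof.
elim: s t F => [|j s IH] t F st.
  by move: st; rewrite perm_sym => /perm_nilP ->.
have jt : j \in t by rewrite -(perm_mem st) mem_head.
case/splitPr: jt st => t1 t2; rewrite perm_sym perm_catC /= perm_cons => st.
rewrite csum_catC /=; apply: eq_bigr => y _; congr (_ * _); apply: IH.
by rewrite perm_sym.
Qed.

(** The sum takes only finitely many values, although [G] may be infinite. *)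
Lemma csum_supp s : exists L : seq G,
  forall F F', {in L, F =1 F'} -> csum s F = csum s F'.
Proof.
elim: s => [|j s [L IH]].
  by exists [:: 0] => F F' /(_ 0)/= ->; rewrite ?inE.
exists (flatten [seq [seq U j y + g | g <- L] | y <- D]) => F F' eqF /=.
elim: D eqF => [|y D' IHD] eqF; first by rewrite !big_nil.
rewrite !big_cons IHD => [|g gD]; last first.
  by apply: eqF => /=; rewrite mem_cat gD orbT.
congr (_ * _ + _); apply: IH => g gL; apply: eqF => /=.
by rewrite mem_cat map_f.
Qed.

Definition cmass s x : R := csum s (fun g => (g == x)%:R).

(** Terms are grouped by the value of the sum. The list [L'] is left free so that different sums can
    be expanded over the same points. *)
Lemma csumE s : exists L : seq G, forall L', uniq L' -> {subset L <= L'} ->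
  forall F, csum s F = \sum_(g <- L') cmass s g * F g.
Proof.
have [L suppL] := csum_supp s; exists L => L' uL' sub F.
rewrite (suppL F (fun h => \sum_(g <- L') F g * (h == g)%:R)).
  by rewrite csum_sum; apply: eq_bigr => g _; rewrite csumZ mulrC.
move=> h /sub hL'; rewrite (bigD1_seq h) //= eqxx mulr1 big1 ?addr0 // => g gh.
by rewrite eq_sym (negbTE gh) mulr0.
Qed.

Variable neg : J -> J.
Hypothesis UN : forall j y, U (neg j) y = - U j y.

Lemma csum_neg s F : csum (map neg s) F = csum s (fun g => F (- g)).
Proof.
elim: s F => [|j s IH] F /=; first by rewrite oppr0.
apply: eq_bigr => y _; rewrite IH UN; congr (_ * _).
by apply: eq_csum => g; rewrite opprD.
Qed.

(** A sum minus an independent copy of itself vanishes exactly when the two copies agree. By [csumE]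
    this mass is therefore the squared l2-norm of [cmass s]. *)
Lemma cmass_cat_neg s :
  cmass (s ++ map neg s) 0 = csum s (cmass s).
Proof.
rewrite /cmass csum_cat; apply: eq_csum => g; rewrite csum_neg.
by apply: eq_csum => h; rewrite subr_eq0 eq_sym.
Qed.

(* Both terms on the right are squared l2-norms of mass functions, whence
   AM-GM applied termwise to the convolution of these functions. *)
Lemma cmass_cat_le s t x :
  2 * cmass (s ++ t) x <=
    cmass (s ++ map neg s) 0 + cmass (t ++ map neg t) 0.
Proof.
rewrite !cmass_cat_neg {1}/cmass csum_cat.
have -> : csum s (fun g => csum t (fun h => (g + h == x)%:R)) =
          csum s (fun g => cmass t (x - g)).
  apply: eq_csum => g; apply: eq_csum => h.
  by rewrite [in RHS]eq_sym subr_eq eq_sym addrC.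
have [Ls Es] := csumE s; have [Lt Et] := csumE t.
(* [L] holds the points needed for [s] and the reflections [x - g] of those needed for [t]; the norm
   for [t], reindexed by this reflection, also becomes a sum over [L]. *)
pose L := undup (Ls ++ [seq x - g | g <- Lt]).
have subK : involutive (fun g => x - g) by move=> g; rewrite subKr.
rewrite !(Es L) ?undup_uniq //;
  try by move=> g gL; rewrite mem_undup mem_cat gL.
rewrite (Et [seq x - g | g <- L]).
- rewrite big_map mulr_sumr -big_split /=; apply: ler_sum => g _.
  have := sqr_ge0 (cmass s g - cmass t (x - g)); nra.
- by rewrite map_inj_uniq ?undup_uniq //; apply: inv_inj.
- move=> g gL; apply/mapP; exists (x - g); last by rewrite subKr.
  by rewrite mem_undup mem_cat (map_f (fun g => x - g)) ?orbT.
Qed.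

End convolution_sum.

(** * Maximal mass among signed index tuples *)

Definition signflip (I : Type) (j : I * bool) := (j.1, ~~ j.2).

(** A pair [(i, b)] stands for the map of index [i], negated when [b] is true. This is the pattern
    of [Y_1 - Y_2 + ... - Y_2m] with the single index [i]. *)
Definition alt_signs (I : Type) (i : I) (m : nat) : seq (I * bool) :=
  mkseq (fun k => (i, odd k)) (m + m).

Lemma alt_signsS (I : Type) (i : I) (m : nat) :
  alt_signs i m.+1 = [:: (i, false), (i, true) & alt_signs i m].
Proof.
rewrite /alt_signs /mkseq addSn addnS /= (iotaDl 2 0) -map_comp.
by congr [:: _, _ & _]; apply: eq_map => k /=; rewrite negbK.
Qed.

(** Each entry and its flip form one pair of opposite signs, whichever sign the entry has. *)
Lemma perm_alt_signs (I : eqType) (i : I) (s : seq (I * bool)) :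
  all (fun j => j.1 == i) s ->
  perm_eq (s ++ map (@signflip I) s) (alt_signs i (size s)).
Proof.
elim: s => [//|[k b] s IH] /= /andP[/eqP -> alls].
rewrite /signflip/= alt_signsS.
rewrite (@perm_trans _ ((i, b) :: (i, ~~ b) :: s ++ map (@signflip I) s)) //.
  by rewrite perm_cons -cat1s perm_catCA.
rewrite (@perm_trans _ ((i, b) :: (i, ~~ b) :: alt_signs i (size s))) //.
  by rewrite !perm_cons IH.
by case: b => //=; exact/permEl/(perm_catCA [:: _] [:: _]).
Qed.

(* A half of a maximizing tuple is chosen with as many occurrences of a fixed
   [i] as possible, so that folding it doubles the number of these, until [i]
   is the only index left. *)
Lemma cmass_le (R : realFieldType) (K : Type) (G : zmodType) (I : finType)
    (D : seq K) (p : K -> R) (U : I * bool -> K -> G) (m : nat) (N : R) :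
  (forall j y, U (signflip j) y = - U j y) -> (0 < m)%N ->
  (forall i, cmass D p U (alt_signs i m) 0 <= N) ->
  forall s x, size s = (m + m)%N -> cmass D p U s x <= N.
Proof.
move=> UN m_gt0 altN s x szs.
set ms := cmass D p U in altN *; set neg := @signflip I.
have split r1 r2 z : 2 * ms (r1 ++ r2) z <=
    ms (r1 ++ map neg r1) 0 + ms (r2 ++ map neg r2) 0 by exact: cmass_cat_le.
have szneg r : size r = m -> size (r ++ map neg r) == (m + m)%N.
  by rewrite size_cat size_map => ->.
pose t0 : (m + m).-tuple (I * bool) := Tuple (introT eqP szs).
(* [M] is the largest mass at 0 among the finitely many tuples of length [m + m]. *)
pose M := ms [arg max_(t > t0) ms (val t) 0]%O 0.
have leM r : size r = (m + m)%N -> ms r 0 <= M.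
  move=> /eqP szr; rewrite /M; case: arg_maxP => //= t _.
  by move=> /(_ (Tuple szr)); apply.
(* Splitting [s] in halves bounds twice its mass at [x] by two masses at 0, each at most [M]. *)
suff MN : M <= N.
  rewrite -(cat_take_drop m s); apply: le_trans MN.
  have sz1 : size (take m s) = m by rewrite size_takel // szs leq_addr.
  have sz2 : size (drop m s) = m by rewrite size_drop szs; lia.
  have := split (take m s) (drop m s) x.
  have := leM _ (eqP (szneg _ sz1)); have := leM _ (eqP (szneg _ sz2)); lra.
(* If [r1 ++ r2] reaches [M], the two folded halves have masses of sum at least [2 * M], each at
   most [M]. *)
have fold r1 r2 : size r1 = m -> size r2 = m -> M <= ms (r1 ++ r2) 0 ->
    M <= ms (r1 ++ map neg r1) 0.
  move=> sz1 sz2; have := split r1 r2 0; have := leM _ (eqP (szneg _ sz2)); lra.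
have [t szt tM] : exists2 t, size t = (m + m)%N & M <= ms t 0.
  by exists (val [arg max_(t > t0) ms (val t) 0]%O); rewrite ?size_tuple.
have [i ct] : exists i, has (fun j => j.1 == i) t.
  case: t szt tM => [|[i b] t] szt _; first by move: szt => /=; lia.
  by exists i; rewrite /= eqxx.
pose c (j : I * bool) := j.1 == i.
rewrite -/c in ct.
(* Induction on the number of entries of [t] whose index is not [i]. *)
have [k] := ubnP (m + m - count c t).
elim: k t szt tM ct => // k IH t szt tM; rewrite has_count => ct ltk.
(* Entries of index [i] come first, so that the half [take m t'] has as many of them as possible. *)
pose t' := [seq j <- t | c j] ++ [seq j <- t | predC c j].
have permt : perm_eq t' t by rewrite /t' perm_filterC.
have szt' : size t' = (m + m)%N by rewrite (perm_size permt).
have sz1 : size (take m t') = m by rewrite size_takel // szt' leq_addr.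
have sz2 : size (drop m t') = m by rewrite size_drop szt'; lia.
have tM' : M <= ms (take m t' ++ map neg (take m t')) 0.
  apply: (fold _ _ sz1 sz2).
  by rewrite cat_take_drop /ms /cmass (perm_csum _ _ _ _ permt).
(* Either the half consists of index [i] only, and folding it gives the alternating tuple up to
   order, or it contains all occurrences of [i], and folding doubles their number. *)
have [mc|cm] := leqP m (count c t).
  have allc : all c (take m t').
    rewrite take_cat size_filter; case: ltnP => [_|cm].
      by apply/allP => j /mem_take; rewrite mem_filter => /andP[].
    have -> : (m - count c t = 0)%N by lia.
    by rewrite take0 cats0 filter_all.
  apply: le_trans (altN i); apply: le_trans tM' _.
  rewrite /ms /cmass.
  by rewrite (perm_csum _ _ _ _ (perm_alt_signs allc)) sz1.
have cneg r : count c (map neg r) = count c r by rewrite count_map.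
have count1 : (count c t <= count c (take m t'))%N.
  rewrite take_cat size_filter ltnNge (ltnW cm) /= count_cat.
  by rewrite count_filter (@eq_count _ _ c) ?leq_addr // => j; rewrite /= andbb.
apply: (IH _ (eqP (szneg _ sz1)) tM').
- by rewrite has_count count_cat addn_gt0 (leq_trans ct count1).
- rewrite count_cat cneg; move: count1 ct cm ltk.
  set a := count _ _; set b := count _ _; lia.
Qed.

Lemma csum_map (R : realFieldType) (K : Type) (G : zmodType) (J J' : eqType)
    (D : seq K) (p : K -> R) (U : J -> K -> G) (h : J' -> J) s F :
  csum D p U (map h s) F = csum D p (U \o h) s F.
Proof.
by elim: s F => [//|j s IH] F /=; apply: eq_bigr => y _; rewrite IH.
Qed.

(** An additive map commutes with the sum, so it passes from the summands to the argument of [F]. *)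
Lemma csum_morph (R : realFieldType) (K : Type) (H G : zmodType) (J : eqType)
    (f : {additive H -> G}) (D : seq K) (p : K -> R)
    (U : J -> K -> H) (U' : J -> K -> G) :
  (forall j y, U' j y = f (U j y)) ->
  forall s F, csum D p U' s F = csum D p U s (F \o f).
Proof.
move=> UU'; elim=> [|j s IH] F /=; first by rewrite raddf0.
apply: eq_bigr => y _; rewrite IH UU'; congr (_ * _).
by apply: eq_csum => g /=; rewrite raddfD.
Qed.

(** * Probabilities of truncated sums as convolution sums *)

Section discrete_sums.
Context {R : realType} {dT dS : measure_display} {T : measurableType dT}
  {S : measurableType dS} (P : probability T R) {I : finType}
  (X : I -> {RV P >-> S}) {G : zmodType} (v : I -> S -> G).
Hypothesis measurable_singleton : forall y : S, measurable [set y].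
Hypothesis indepX : mutually_independent X.
Variable p : S -> R.
Hypothesis pE : forall i y, P (X i @^-1` [set y]) = (p y)%:E.

(** Induction on [r], fixing one value at a time: [J] and [B] record the values already fixed and
    [c] accumulates their contribution. Independence enters in the base case, where the event is an
    intersection of events [X j = B j]. *)
Lemma probability_truncated_sum_cond (D : {fset S}) (r : seq I) :
  uniq r -> forall (J : {set I}) (B : I -> S) (c x : G),
  {in r, forall i, i \notin J} ->
  let E := [set w | [/\ forall j, j \in J -> X j w = B j,
                       forall i, i \in r -> X i w \in D &
                       c + \sum_(i <- r) v i (X i w) = x]] in
  measurable E /\
  P E = (\prod_(j in J) p (B j) *
         csum D p v r (fun g => (c + g == x)%:R))%:E.
Proof.
elim: r => [|i r IH] uir J B c x rJ E.
  have -> : E = if c == x then \bigcap_(j in [set` J]) (X j @^-1` [set B j])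
                else set0.
    apply/seteqP; split => w; rewrite /E /= big_nil addr0.
      by case=> XB _ ->; rewrite eqxx => j /= /XB.
    by case: eqP => // cx XB.
  rewrite /= addr0; case: eqP => _; last by rewrite measure0 mulr0; split.
  split.
    apply: fin_bigcap_measurable => // j _.
    by rewrite -[X in measurable X]setTI; exact: measurable_funPT.
  rewrite (indepX (A := fun j => [set B j])) // mulr1 -prodEFin.
  by apply: eq_bigr => j _; exact: pE.
have /andP[ir ur] := uir.
pose B' y j := if j == i then y else B j.
pose F y := [set w | [/\ forall j, j \in i |: J -> X j w = B' y j,
                       forall i, i \in r -> X i w \in D &
                       c + v i y + \sum_(i <- r) v i (X i w) = x]].
have iJ : i \notin J by apply: rJ; rewrite mem_head.
have rJ' : {in r, forall k, k \notin i |: J}.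
  move=> k kr; rewrite !inE negb_or rJ ?inE ?kr ?orbT // andbT.
  by apply: contraNneq ir => <-.
(* The event splits according to the value [y] of [X i]; then [i] joins [J] and [v i y] is added to
   [c]. *)
have EF : E = \big[setU/set0]_(y <- D) F y.
  rewrite -bigcup_fset; apply/seteqP; split => w; rewrite /E /= big_cons.
    move=> [XB XD Xx]; exists (X i w); first by apply: XD; rewrite mem_head.
    split; last by rewrite -addrA.
      by move=> j; rewrite !inE /B'; case: eqP => [->//|_ /= /XB].
    by move=> k kr; apply: XD; rewrite inE kr orbT.
  move=> [y /= yD [XB XD Xx]].
  have Xi : X i w = y by rewrite XB ?setU11 // /B' eqxx.
  split; last by rewrite Xi addrA.
    move=> j jJ; rewrite XB ?setU1r // /B'; case: eqP => // ji.
    by move: iJ; rewrite -ji jJ.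
  by move=> k; rewrite inE => /orP[/eqP ->|/XD//]; rewrite Xi.
have FP y := IH ur (i |: J) (B' y) (c + v i y) x rJ'.
rewrite EF; split; first by apply: bigsetU_measurable => y _; have [] := FP y.
rewrite measure_fbigsetU; first last.
- move=> y z _ _ [w [[Fy _ _] [Fz _ _]]].
  have := Fy i (setU11 _ _); have := Fz i (setU11 _ _).
  by rewrite /B' eqxx => -> ->.
- by move=> y _; have [] := FP y.
rewrite /= mulr_sumr -sumEFin; apply: eq_bigr => y _.
have [_ ->] := FP y; congr _%:E.
rewrite big_setU1 //= {1}/B' eqxx mulrCA mulrA; congr (_ * _ * _).
  apply: eq_bigr => j jJ; rewrite /B'; case: eqP => // ji.
  by rewrite -ji jJ in iJ.
by apply: eq_csum => g; rewrite addrA.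
Qed.

Lemma probability_truncated_sum (D : {fset S}) (x : G) :
  let E := [set w | (forall i, X i w \in D) /\ \sum_i v i (X i w) = x] in
  measurable E /\ P E = (cmass D p v (enum I) x)%:E.
Proof.
move=> E.
(* Nothing is fixed at the start; [point] is a mere placeholder. *)
have [|mE PE] := probability_truncated_sum_cond D (enum_uniq I)
    (J := finset.set0) (fun=> point) 0 x; first by move=> i; rewrite inE.
have -> : E = [set w | [/\ forall j, j \in finset.set0 -> X j w = point,
                       forall i, i \in enum I -> X i w \in D &
                       0 + \sum_(i <- enum I) v i (X i w) = x]].
  apply/seteqP; split => w; rewrite /E /= add0r big_enum /=.
    by case=> XD ->; split => // j; rewrite inE.
  by case=> _ XD ->; split => // i; apply: XD; rewrite mem_enum.
split=> //; rewrite PE big_set0 mul1r; congr _%:E.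
by apply: eq_csum => g; rewrite add0r.
Qed.

End discrete_sums.

(** * From finite sets of values to countable ones *)

Lemma countable_exhaustion (S : pointedType) (C : set S) : countable C ->
  exists D : nat -> {fset S}, {homo D : k l / (k <= l)%N >-> (k `<=` l)%fset} /\
    forall y, C y -> exists k, y \in D k.
Proof.
move=> /countable_injP[f injf].
(* [g] inverts [f] on [C], with default [point] at integers that [f] does not reach. *)
pose g j : S := xget point [set y | C y /\ f y = j].
exists (fun k => [fset y in map g (iota 0 k)]%fset); split.
  move=> k l kl; apply/fsubsetP => y; rewrite !inE => /mapP[j jk ->].
  by apply: map_f; move: jk; rewrite !mem_iota => /leq_trans; apply.
move=> y Cy; exists (f y).+1; rewrite in_fset; apply/mapP; exists (f y).
  by rewrite mem_iota ltnS leqnn.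
have [Cg fg] : [set z | C z /\ f z = f y] (g (f y)) by apply: xgetPex; exists y.
by apply: injf => //; rewrite inE.
Qed.

(** Common form of both situations: of multiplication by [a_i], only additivity and injectivity
    matter. The map [e] reads values of [S] in the group [H]. *)
Lemma probability_sum_le (R : realType) (dT dS : measure_display)
    (T : measurableType dT) (S : measurableType dS) (P : probability T R)
    (n : nat) (H G : zmodType) (e : S -> H) (f : 'I_n -> {additive H -> G})
    (X : 'I_n -> {RV P >-> S}) (x : G) :
  (forall y : S, measurable [set y]) ->
  (0 < n)%N -> ~~ odd n -> (forall i, injective (f i)) ->
  mutually_independent X -> identically_distributed X ->
  (forall i, discrete_rv (X i)) ->
  let E := [set w | \sum_(i < n) f i (e (X i w)) = x] in
  let E0 := [set w |
    \sum_(i < n) (if odd i then - e (X i w) else e (X i w)) = 0] in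
  measurable E -> measurable E0 -> (P E <= P E0)%E.
Proof.
move=> mS n_gt0 n_even injf indepX idX discX E E0 mE mE0.
pose p y := fine (P (X (Ordinal n_gt0) @^-1` [set y])).
have mX i y : measurable (X i @^-1` [set y]).
  by rewrite -[X in measurable X]setTI; exact: measurable_funPT.
have pE i y : P (X i @^-1` [set y]) = (p y)%:E.
  rewrite /p fineK ?fin_num_measure //.
  exact: (idX i (Ordinal n_gt0) [set y] (mS y)).
have nm : n = (n./2 + n./2)%N.
  by rewrite addnn -[LHS]odd_double_half (negbTE n_even).
have m_gt0 : (0 < n./2)%N by lia.
pose V (b : bool) y := if b then - e y else e y.
pose U (j : 'I_n * bool) y := if j.2 then - f j.1 (e y) else f j.1 (e y).
pose t (D : {fset S}) := [set w | forall i, X i w \in D].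
(* On [t D] the inequality is one between convolution sums; on its right-hand side the truncation is
   then dropped by monotonicity. *)
have tE (D : {fset S}) : measurable (t D `&` E) /\ (P (t D `&` E) <= P E0)%E.
  have [mED PED] :=
    probability_truncated_sum (fun i y => f i (e y)) mS indepX pE D x.
  have [mE0D PE0D] :=
    probability_truncated_sum (fun (i : 'I_n) y => V (odd i) y)
      mS indepX pE D 0.
  split=> //.
  apply: (@le_trans _ _ (P (t D `&` E0))); last first.
    by apply: le_measure; rewrite ?inE //; exact: subIsetr.
  rewrite [leLHS]PED [leRHS]PE0D lee_fin.
  have -> : cmass D p (fun i y => f i (e y)) (enum 'I_n) x =
            cmass D p U [seq (i, false) | i <- enum 'I_n] x.
    by rewrite /cmass [RHS]csum_map.
  have -> : cmass D p (fun i : 'I_n => V (odd i)) (enum 'I_n) 0 =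
            cmass D p V (mkseq odd n) 0.
    by rewrite /cmass /mkseq -val_enum_ord -map_comp [RHS]csum_map.
  apply: (@cmass_le _ _ _ _ _ _ _ n./2) => //.
  - by move=> [i []] y; rewrite /U //= opprK.
  - move=> i; have -> : alt_signs i n./2 = [seq (i, b) | b <- mkseq odd n].
      by rewrite /mkseq -map_comp /alt_signs -nm.
    (* With a single index, the sum is the image under [f i] of the alternating sum; by injectivity
       both vanish together. *)
    rewrite /cmass csum_map (@csum_morph _ _ _ _ _ (f i) D p V).
      rewrite le_eqVlt; apply/orP; left; apply/eqP.
      by apply: eq_csum => g /=; rewrite -(inj_eq (@injf i)) raddf0.
    by move=> [] y; rewrite /U /V //= raddfN.
  - by rewrite size_map size_enum_ord.
have [C cC XC] : exists2 C : set S, countable C &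
    {ae P, forall w, forall i, C (X i w)}.
  pose C i := projT1 (cid2 (discX i)).
  exists (\bigcup_i C i).
    by apply: bigcup_countable => // i _; rewrite /C; case: cid2.
  apply: filter_forall => i.
  have : {ae P, forall w, C i (X i w)} by rewrite /C; case: cid2.
  by apply: filterS => w Cw; exists i.
have [D [homoD CD]] := countable_exhaustion cC.
have [N [mN PN CN]] := XC.
have mtE : measurable (\bigcup_k (t (D k) `&` E)) :=
  bigcup_measurable (fun k _ => (tE (D k)).1).
(* Outside the null set [N], every outcome of [E] lies in some [t (D k)]; the largest of the
   finitely many ranks [k i] serves all variables. *)
apply: (@le_trans _ _ (P (\bigcup_k (t (D k) `&` E)))).
  rewrite -(measureU0 mtE mN PN).
  apply: le_measure; rewrite ?inE //; first exact: measurableU.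
  move=> w Ew; have [XCw|/CN] := pselect (forall i, C (X i w)); last by right.
  left; have /choice[k Xk] i := CD _ (XCw i).
  exists (\max_i k i)%N => //; split=> // i.
  by have /fsubsetP := homoD _ _ (leq_bigmax (F := k) i); apply.
(* Continuity from below carries the bound for each [D k] over to the union. *)
have tcvg := @nondecreasing_cvg_mu _ _ _ P (fun k => t (D k) `&` E)
  (fun k => (tE (D k)).1) mtE.
rewrite -(cvg_lim _ (tcvg _)) //; last first.
  move=> k l kl; apply/subsetPset => w [tw Ew]; split => // i.
  by have /fsubsetP := homoD _ _ kl; apply.
apply: lime_le.
  apply/cvg_ex; eexists; apply: tcvg => k l kl.
  apply/subsetPset => w [tw Ew]; split => // i.
  by have /fsubsetP := homoD _ _ kl; apply.
by apply: nearW => k; exact: (tE (D k)).2.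
Qed.

(** * Measurability in the Borel space of row vectors *)

Lemma measurable_eq_rV (R : realType) (dT : measure_display)
    (T : measurableType dT) (d : nat) (Y : T -> 'rV[R]_d) (x : 'rV[R]_d) :
  (forall j, measurable_fun setT (fun w => Y w 0 j)) ->
  measurable [set w | Y w = x].
Proof.
move=> mY.
have -> : [set w | Y w = x] =
    \bigcap_(j in [set: 'I_d]) ((fun w => Y w 0 j) @^-1` [set x 0 j]).
  apply/seteqP; split => w /=; first by move=> <- j _.
  by move=> Yx; apply/rowP => j; exact: Yx.
apply: fin_bigcap_measurable; first exact: finite_finset.
by move=> j _; rewrite -[X in measurable X]setTI; apply: mY.
Qed.

Lemma measurable_coord (R : realType) (d : nat) (j : 'I_d) :
  measurable_fun setT (fun y : borelRd R d => (y : 'rV[R]_d) 0 j).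
Proof.
apply: (measurability _ (RGenOInfty.measurableE R)) => _ [_ [r ->] <-].
rewrite setTI; apply: sub_sigma_algebra.
have /continuousP := @coord_continuous R 1 d 0 j; apply.
by rewrite set_itv_o_infty; exact: open_gt.
Qed.

(** The norm topology is Hausdorff, so singletons are closed. *)
Lemma measurable_set1_borelRd (R : realType) (d : nat) (y : borelRd R d) :
  measurable [set y].
Proof.
rewrite -[X in measurable X]setCK; apply: measurableC.
apply: sub_sigma_algebra; apply: closed_openC.
apply: accessible_closed_set1; apply: hausdorff_accessible.
exact: (@norm_hausdorff R 'rV[R]_d).
Qed.

(** Named, with the vector as the fixed argument, so that it can carry the additive structure
    required of the maps in situation (a). *)
Definition scale_vector (R : pzRingType) (V : lmodType R) (v : V) (r : R) : V :=
  r *: v.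

Lemma scale_vector_is_zmod_morphism (R : pzRingType) (V : lmodType R) (v : V) :
  zmod_morphism (scale_vector v).
Proof. by move=> r s; rewrite /scale_vector scalerBl. Qed.

HB.instance Definition _ (R : pzRingType) (V : lmodType R) (v : V) :=
  GRing.isZmodMorphism.Build R V (scale_vector v)
    (scale_vector_is_zmod_morphism v).

Theorem corollary1 (R : realType) (dT : measure_display)
    (T : measurableType dT) (P : probability T R) (d n : nat)
    (n_gt0 : (0 < n)%N) (n_even : ~~ odd n) (x : 'rV[R]_d) :
  (forall (X : 'I_n -> {RV P >-> R}) (a : 'I_n -> 'rV[R]_d),
     mutually_independent X -> identically_distributed X ->
     (forall i, discrete_rv (X i)) -> (forall i, a i != 0) ->
     (P [set w | (\sum_(i < n) X i w *: a i)%R = x]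
        <= P [set w | (\sum_(i < n) (-1) ^+ i * X i w)%R = 0%R])%E) /\
  (forall (X : 'I_n -> {RV P >-> borelRd R d}) (a : 'I_n -> R),
     mutually_independent X -> identically_distributed X ->
     (forall i, discrete_rv (X i)) -> (forall i, a i != 0) ->
     (P [set w | (\sum_(i < n) a i *: (X i w : 'rV[R]_d))%R = x]
        <= P [set w | (\sum_(i < n) (-1) ^+ i *: (X i w : 'rV[R]_d))%R = 0%R])%E).
Proof.
split=> X a indepX idX discX a0.
- have E0 : [set w | \sum_(i < n) (-1) ^+ i * X i w = 0] =
            [set w | \sum_(i < n) (if odd i then - X i w else X i w) = 0].
    apply: eq_set => w; congr (_ = _); apply: eq_bigr => i _.
    by rewrite -signr_odd; case: odd; rewrite ?mulN1r ?mul1r.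
  have mE0 : measurable [set w | \sum_(i < n) (-1) ^+ i * X i w = 0].
    rewrite (_ : [set w | _] =
                 (fun w => \sum_(i < n) (-1) ^+ i * X i w) @^-1` [set 0]) //.
    rewrite -[X in measurable X]setTI; apply: measurable_sum => // i.
    exact: measurable_funM.
  rewrite E0 in mE0 *.
  apply: (@probability_sum_le _ _ _ _ _ P n R 'rV[R]_d id
    (fun i => scale_vector (a i)) X x) => //.
    (* Injectivity: [(r - s) *: a i = 0] with [a i] non-zero forces [r = s]. *)
    move=> i r s /eqP; rewrite /= /scale_vector -subr_eq0 -scalerBl scaler_eq0.
    by rewrite (negbTE (a0 i)) orbF subr_eq0 => /eqP.
  apply: measurable_eq_rV => j; under eq_fun do rewrite summxE.
  apply: measurable_sum => i; under eq_fun do rewrite mxE.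
  exact: measurable_funM.
- have mX i j : measurable_fun setT (fun w => (X i w : 'rV[R]_d) 0 j).
    exact: measurableT_comp (@measurable_coord R d j) _.
  have msum (c : 'I_n -> R) y :
      measurable [set w | \sum_(i < n) c i *: (X i w : 'rV[R]_d) = y].
    apply: measurable_eq_rV => j; under eq_fun do rewrite summxE.
    apply: measurable_sum => i; under eq_fun do rewrite mxE.
    exact: measurable_funM.
  have E0 : [set w | \sum_(i < n) (-1) ^+ i *: (X i w : 'rV[R]_d) = 0] =
            [set w | \sum_(i < n)
               (if odd i then - (X i w : 'rV[R]_d) else X i w) = 0].
    apply: eq_set => w; congr (_ = _); apply: eq_bigr => i _.
    by rewrite -signr_odd; case: odd; rewrite ?scaleN1r ?scale1r.
  have mE0 := msum (fun i => (-1) ^+ i) 0.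
  rewrite E0 in mE0 *.
  apply: (probability_sum_le (e := fun y : borelRd R d => y : 'rV[R]_d)
    (f := fun i => *:%R (a i))) => //.
    exact: measurable_set1_borelRd.
    by move=> i; exact: scalerI.
  exact: msum.
Qed.
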